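(* Let $\Sigma$ be a signed graph. Then $\Sigma$ is clusterable if and only if the contraction $|\Sigma|/E^+(\Sigma)$ has no loops, and (when $\Sigma$ is clusterable) its cluster number is $\operatorname{clu}(\Sigma)=\chi(|\Sigma|/E^+(\Sigma))$.
   Context: A signed graph $\Sigma=(\Gamma,\sigma)$ has underlying graph $|\Sigma|=\Gamma=(V,E)$ and $\sigma:E\to\{+,-\}$; $E^+$ is the set of positive edges. $\Sigma$ is clusterable if $V$ can be partitioned into nonempty sets (clusters) so that every edge inside a cluster is positive and every edge between two different clusters is negative; the cluster number $\operatorname{clu}(\Sigma)$ is the smallest number of clusters of such a partition. The contraction $\Gamma/S$ for $S\subseteq E$ is obtained by shrinking each connected component of the spanning subgraph $(V,S)$ to a single vertex and deleting the edges of $S$; any other edge whose endpoints lie in the same component becomes a loop. $\chi$ denotes the ordinary chromatic number of a loopless graph. *)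

(* Defs.v *)
From mathcomp Require Import all_boot.

Set Implicit Arguments.
Unset Strict Implicit.
Unset Printing Implicit Defensive.

(* Finite graphs in which loops and parallel edges are allowed: an edge is an
   abstract object whose set of ends has one element (a loop) or two. *)
Record multigraph := Multigraph {
  vertex : finType;
  edge : finType;
  ends : edge -> {set vertex};
  endsP : forall e, 0 < #|ends e| <= 2
}.

Section Multigraph.
Variable G : multigraph.

Definition is_loop (e : edge G) : bool := #|ends e| == 1.

Definition loopless : bool := [forall e : edge G, ~~ is_loop e].

Definition proper_coloring k (c : {ffun vertex G -> 'I_k}) : bool :=
  [forall e : edge G, forall x, forall y,
     (ends e == [set x; y]) ==> (c x != c y)].

Definition colorable k : bool :=
  [exists c : {ffun vertex G -> 'I_k}, proper_coloring c].

Lemma loopless_colorable : loopless -> exists k, colorable k.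
Proof.
move=> /forallP noloop; exists #|vertex G|; apply/existsP.
exists [ffun x => enum_rank x].
apply/forallP=> e; apply/forallP=> x; apply/forallP=> y; apply/implyP=> /eqP exy.
rewrite !ffunE (inj_eq enum_rank_inj); apply: contraNneq (noloop e) => eq_xy.
by rewrite /is_loop exy eq_xy setUid cards1.
Qed.

Definition chromatic_number (h : loopless) : nat :=
  ex_minn (loopless_colorable h).

Variable S : {set edge G}.

Definition adjacent_in (x y : vertex G) : bool :=
  [exists e in S, ends e == [set x; y]].

Definition component_of (x : vertex G) : {set vertex G} :=
  [set y | connect adjacent_in x y].

Definition components : {set {set vertex G}} :=
  [set component_of x | x : vertex G].

Definition shrink (x : vertex G) : {C : {set vertex G} | C \in components} :=
  exist _ (component_of x) (imset_f component_of (erefl (x \in vertex G))).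

Definition contraction_ends (e : {e : edge G | e \notin S}) :
    {set {C : {set vertex G} | C \in components}} :=
  [set shrink x | x in ends (val e)].

Lemma contraction_endsP e : 0 < #|contraction_ends e| <= 2.
Proof.
have /andP[e_gt0 e_le2] := endsP (val e).
rewrite (leq_trans (leq_imset_card _ _) e_le2) andbT.
have /card_gt0P[x xe] := e_gt0.
by apply/card_gt0P; exists (shrink x); apply: imset_f.
Qed.

Definition contraction : multigraph := Multigraph contraction_endsP.

End Multigraph.

(* [sign e] is [true] for a positive edge and [false] for a negative one. *)
Record signed_graph := SignedGraph {
  underlying : multigraph;
  sign : edge underlying -> bool
}.

Section SignedGraph.
Variable Sigma : signed_graph.
Local Notation V := (vertex (underlying Sigma)).
Local Notation E := (edge (underlying Sigma)).

Definition positive_edges : {set E} := [set e | sign e].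

(* [partition] already requires the blocks to be nonempty. *)
Definition clustering (P : {set {set V}}) : bool :=
  [&& partition P [set: V],
      [forall e : E, forall B in P, (ends e \subset B) ==> sign e] &
      [forall e : E, forall B in P, forall C in P,
         [&& B != C, ends e :&: B != set0 & ends e :&: C != set0]
           ==> ~~ sign e]].

Definition clusterable : bool := [exists P, clustering P].

Definition clusterable_with k : bool :=
  [exists P, clustering P && (#|P| == k)].

Lemma clusterable_number : clusterable -> exists k, clusterable_with k.
Proof.
by move=> /existsP[P cP]; exists #|P|; apply/existsP; exists P; rewrite cP /=.
Qed.

Definition cluster_number (h : clusterable) : nat :=
  ex_minn (clusterable_number h).

End SignedGraph.

(* Main.v *)
Require Import Defs.
From mathcomp Require Import all_boot.

(** A clustering is the same thing as a labelling of the vertices for which an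
    edge is positive exactly when its ends have equal labels.  Such a labelling
    is constant along positive edges, so it factors through the components of
    the positive subgraph; on the contraction, whose edges are the negative
    ones, the remaining condition is properness of the induced colouring. *)

Lemma ends_pair (G : multigraph) (e : edge G) :
  exists x y, ends e = [set x; y].
Proof.
have /andP[e_gt0] := endsP e; rewrite leq_eqVlt ltnS => /orP[/cards2P|e_le1].
  by case=> x [y] [_ ->]; exists x, y.
have /cards1P[x ->] : #|ends e| == 1 by rewrite eqn_leq e_le1.
by exists x, x; rewrite setUid.
Qed.

Lemma proper_coloringP (G : multigraph) k (c : {ffun vertex G -> 'I_k}) :
  reflect (forall e x y, ends e = [set x; y] -> c x != c y)
          (proper_coloring c).
Proof.
apply: (iffP forallP) => [cP e x y /eqP|cP e].
  by move: (cP e) => /forallP/(_ x)/forallP/(_ y)/implyP; apply.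
by do 2![apply/forallP=> ?]; apply/implyP=> /eqP; apply: cP.
Qed.

Lemma colorable_loopless {G : multigraph} {k} : colorable G k -> loopless G.
Proof.
case/existsP=> c /proper_coloringP cP; apply/forallP=> e.
apply/negP=> /cards1P[x ex].
by have := cP e x x; rewrite setUid ex eqxx => /(_ erefl).
Qed.

(** Blocks are the fibres over the attained labels; labels without a preimage give no block, hence
    only an inequality. *)
Lemma card_preim_partition (T : finType) k (f : T -> 'I_k) (D : {set T}) :
  #|preim_partition f D| <= k.
Proof.
rewrite -[k in _ <= k]card_ord -cardsT.
have -> : preim_partition f D =
          (fun i => [set y in D | i == f y]) @: (f @: D).
  by rewrite -imset_comp.
apply: leq_trans (leq_imset_card _ _) _.
exact: subset_leq_card (subsetT _).
Qed.

Lemma adjacent_in_connect_eq {G : multigraph} {S : {set edge G}}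
    {T : eqType} {f : vertex G -> T} :
  (forall e x y, e \in S -> ends e = [set x; y] -> f x = f y) ->
  forall x y, connect (adjacent_in S) x y -> f x = f y.
Proof.
move=> fS x y /connectP[p]; elim: p x => [|z p IHp] x /= => [_ -> //|].
by case/andP=> /exists_inP[e eS /eqP exz] /IHp{}IHp /IHp <-; apply: fS exz.
Qed.

(** Ends are unordered, so adjacency is symmetric and connectedness is an equivalence whose classes
    are the components. *)
Lemma shrink_eqP (G : multigraph) (S : {set edge G}) (x y : vertex G) :
  reflect (shrink S x = shrink S y) (connect (adjacent_in S) x y).
Proof.
have adjC : symmetric (adjacent_in S).
  by move=> a b; rewrite /adjacent_in; apply: eq_existsb => e; rewrite setUC.
have connC := sym_connect_sym adjC.
apply: (iffP idP) => [xy|/(congr1 val)/= /setP/(_ y)].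
  apply: val_inj; apply/setP=> z; rewrite !inE.
  exact: (same_connect connC).
by rewrite !inE connect0.
Qed.

Lemma shrink_surj (G : multigraph) (S : {set edge G}) C :
  exists x, C = shrink S x.
Proof.
by have /imsetP[x _ Cx] := valP C; exists x; apply: val_inj.
Qed.

Section Clustering.
Variable Sigma : signed_graph.
Local Notation V := (vertex (underlying Sigma)).
Local Notation S := (positive_edges Sigma).

Lemma clustering_preimP (T : eqType) (f : V -> T) :
  reflect (forall e x y, ends e = [set x; y] -> sign e = (f x == f y))
          (clustering (preim_partition f [set: V])).
Proof.
set P := preim_partition f _.
have blockE x : [set y in [set: V] | f x == f y] \in P by apply: imset_f.
apply: (iffP and3P) => [[_ Pin Pout] e x y exy|fP].
  have /implyP in_xy := forall_inP (forallP Pin e) _ (blockE x).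
  have /forall_inP/(_ _ (blockE y))/implyP out_xy :=
    forall_inP (forallP Pout e) _ (blockE x).
  case: eqVneq => [fxy|fxy].
    by apply: in_xy; rewrite exy subUset !sub1set !inE fxy !eqxx.
  apply/negbTE/out_xy/and3P; split.
  (* If the two blocks coincided, [x] would lie in the block of [y], so the labels would agree. *)
  - apply: contraNneq fxy => /setP/(_ x).
    by rewrite !inE eqxx /= eq_sym => <-.
  - by apply/set0Pn; exists x; rewrite exy !inE !eqxx.
  by apply/set0Pn; exists y; rewrite exy !inE !eqxx orbT.
split; first exact: preim_partitionP.
  apply/forallP=> e; apply/forall_inP=> _ /imsetP[z _ ->]; apply/implyP.
  have [x [y exy]] := ends_pair _ e.
  rewrite (fP _ _ _ exy) exy subUset !sub1set !inE /=.
  by case/andP=> /eqP <- /eqP <-.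
apply/forallP=> e; apply/forall_inP=> _ /imsetP[z _ ->].
apply/forall_inP=> _ /imsetP[t _ ->]; apply/implyP.
case/and3P=> ztN /set0Pn[u] /setIP[ue] /setIdP[_ /eqP zu].
case/set0Pn=> v /setIP[ve] /setIdP[_ /eqP tv].
have [x [y exy]] := ends_pair _ e.
(* A positive edge has one label on all its ends, in particular on [u] and [v], which merges the two
   blocks. *)
apply: contraNN ztN; rewrite (fP _ _ _ exy) => /eqP fxy; apply/eqP/setP=> w.
suff fuv : f u = f v by rewrite !inE zu tv fuv.
by move: ue ve; rewrite exy => /set2P[]-> /set2P[]->.
Qed.

(** Every partition is the fibre partition of its own block map, so [pblock P] serves as the
    labelling. *)
Lemma clustering_pblock {P : {set {set V}}} :
  clustering P ->
  forall e x y, ends e = [set x; y] -> sign e = (pblock P x == pblock P y).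
Proof.
move=> cP; have /and3P[partP _ _] := cP.
by apply/clustering_preimP; rewrite preim_partition_pblock.
Qed.

(** Each positive component lies in a single cluster, and that cluster is its colour. *)
Lemma clustering_colorable {P : {set {set V}}} :
  clustering P -> colorable (contraction S) #|P|.
Proof.
move=> cP; have signE := clustering_pblock cP.
have /and3P[/and3P[/eqP covP _ _] _ _] := cP.
have inP x : pblock P x \in P by rewrite pblock_mem // covP inE.
have constP x y : shrink S x = shrink S y -> pblock P x = pblock P y.
  move/shrink_eqP; apply: adjacent_in_connect_eq => e u v.
  by rewrite inE => se euv; apply/eqP; rewrite -(signE _ _ _ euv).
(* The colouring must be a function, so a representative vertex of each component is chosen. *)
have rep C : {x | C = shrink S x}.
  have exC : exists x, C == shrink S x.
    by have [x ->] := shrink_surj _ _ C; exists x.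
  by exists (xchoose exC); apply/eqP/(xchooseP exC).
apply/existsP; exists [ffun C => enum_rank_in (inP (sval (rep C)))
                                  (pblock P (sval (rep C)))].
apply/proper_coloringP=> e C D eCD; rewrite !ffunE.
have [x [y exy]] := ends_pair _ (val e).
case: (rep C) (rep D) => [u Cu] [v Dv] /=.
(* Equal colours on [C] and [D] would put all ends of [e] in one cluster, making [e] positive,
   although only negative edges survive contraction. *)
apply: contraNneq (valP e); rewrite inE (signE _ _ _ exy).
move=> /(enum_rank_in_inj (inP u) (inP v)) Puv.
have endP z : z \in ends (val e) -> pblock P z = pblock P u.
  move=> ze; have : shrink S z \in [set C; D] by rewrite -eCD; apply: imset_f.
  by rewrite Cu Dv => /set2P[]/constP->.
by rewrite !endP ?exy ?set21 ?set22.
Qed.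

Lemma colorable_clustering {k} :
  colorable (contraction S) k ->
  exists2 P : {set {set V}}, clustering P & #|P| <= k.
Proof.
case/existsP=> c /proper_coloringP cP.
exists (preim_partition (fun x => c (shrink S x)) [set: V]); last first.
  exact: card_preim_partition.
apply/clustering_preimP=> e x y exy; case se: (sign e).
  suff -> : shrink S x = shrink S y by rewrite eqxx.
  apply/shrink_eqP/connect1; apply/exists_inP; exists e; first by rewrite inE.
  exact/eqP.
have eS : e \notin S by rewrite inE se.
apply/esym/negbTE/(cP (exist _ e eS)).
by rewrite /= /contraction_ends /= exy imsetU1 imset_set1.
Qed.

End Clustering.

Theorem theorem10p2 (Sigma : signed_graph) :
  (clusterable Sigma <->
     loopless (contraction (positive_edges Sigma))) /\
  (forall (hclu : clusterable Sigma)
          (hloop : loopless (contraction (positive_edges Sigma))),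
     cluster_number hclu = chromatic_number hloop).
Proof.
split; first split.
- by case/existsP=> P /clustering_colorable/colorable_loopless.
- case/loopless_colorable=> k /colorable_clustering[P cP _].
  by apply/existsP; exists P.
move=> hclu hloop; rewrite /cluster_number /chromatic_number.
case: ex_minnP => n /existsP[Q /andP[cQ /eqP <-]] minQ.
case: ex_minnP => m col_m min_m; apply/eqP; rewrite eqn_leq.
(* The optimal clustering [Q] bounds the chromatic number by [#|Q|]; conversely, an optimal
   colouring yields a clustering [P] with at most [m] blocks, and [Q] is no larger than [P]. *)
rewrite min_m ?andbT; last exact: clustering_colorable.
have [P cP leP] := colorable_clustering _ col_m.
by apply: leq_trans leP; apply: minQ; apply/existsP; exists P; rewrite cP /=.
Qed.
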